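(* Let $GS_n^{(H)} = \sum_{k=F_n+1}^{F_{n+1}-1} \frac1k$ be the harmonic gap-sum of the Fibonacci sequence. Then $$GS_n^{(H)} = \ln(\alpha) + O(\alpha^{-n}), \qquad n\to\infty.$$ In particular, $\lim_{n\to\infty} GS_n^{(H)} = \ln(\alpha)$ (numerically $\approx 0.4812$).
   Context: $F_n$ ($n\ge1$) are the Fibonacci numbers: $F_1=F_2=1$, $F_n=F_{n-1}+F_{n-2}$ for $n\ge3$. $\alpha = \frac{1+\sqrt5}{2}$ is the golden ratio. Empty sums are $0$. *)

(* Defs.v *)
From mathcomp Require Import all_boot all_order all_algebra.
From mathcomp Require Import all_classical all_reals all_analysis.

Set Implicit Arguments.
Unset Strict Implicit.
Unset Printing Implicit Defensive.

Import Order.TTheory GRing.Theory Num.Theory.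
Import numFieldNormedType.Exports.

Local Open Scope ring_scope.

(* The value at 0 extends the sequence F_1 = F_2 = 1 backwards; only the
   indices n >= 1 are meaningful, which is harmless for limits at infinity. *)
Fixpoint fib (n : nat) : nat :=
  match n with
  | 0 => 0
  | 1 => 1
  | (m.+1 as p).+1 => fib p + fib m
  end%N.

Definition golden_ratio (R : realType) : R := (1 + Num.sqrt 5) / 2.

Definition harmonic_gap_sum (R : realType) (n : nat) : R :=
  \sum_((fib n).+1 <= k < fib n.+1) k%:R^-1.

(* Main.v *)
Require Import Defs.
From mathcomp Require Import all_boot all_order all_algebra.
From mathcomp Require Import all_classical all_reals all_analysis.
From mathcomp Require Import ring lra.

Set Implicit Arguments.
Unset Strict Implicit.
Unset Printing Implicit Defensive.

Import Order.TTheory GRing.Theory Num.Theory.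
Import numFieldNormedType.Exports.

Local Open Scope classical_set_scope.
Local Open Scope ring_scope.

(** Write p and q for the consecutive Fibonacci numbers F_n and F_(n+1), and a
    for the golden ratio. The gap-sum of 1/k over p < k < q is a Riemann sum of
    1/t, so it differs from ln q - ln p by at most 1/p
    ([sum_inv_between]). On the other side, q - a p is exactly the n-th power
    of the conjugate 1 - a = - 1/a ([fib_golden_ratio]), of absolute value
    a^-n; since ln is 1-Lipschitz on [1, +oo[, ln q - ln p differs from ln a
    by at most a^-n. Finally 1/p <= a^2 a^-n ([fib_inv_le]). The total error is
    at most (a^2 + 1) a^-n, which gives the big-O estimate and, as a > 1, the
    limit.

    The decimal value comes from bracketing a between two quotients of
    consecutive Fibonacci numbers and comparing them with the exponentials of
    115/239 and 77/160, which are estimated by Taylor polynomials of degree 5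
    with an explicit remainder ([expR_taylor_bounds]). *)

(** * Logarithms and sums of reciprocals *)

(** The tangent-line bound for the concave function ln at x. Exchanging x and y
    turns it into a lower bound, so it supplies both halves of every
    comparison between differences of ln and reciprocals below. *)
Lemma lnB_le (R : realType) (x y : R) :
  0 < x -> 0 < y -> ln y - ln x <= (y - x) / x.
Proof.
move=> x0 y0; rewrite -ln_div ?posrE//.
have -> : y / x = 1 + (y - x) / x by field; rewrite gt_eqF.
apply: le_ln1Dx.
have -> : (y - x) / x = y / x - 1 by field; rewrite gt_eqF.
by rewrite ltrDr divr_gt0.
Qed.

Lemma ln_lipschitz (R : realType) (x y : R) :
  1 <= x -> 1 <= y -> `|ln y - ln x| <= `|y - x|.
Proof.
suff H (u v : R) : 1 <= u -> 1 <= v -> ln v - ln u <= `|v - u|.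
  by move=> x1 y1; rewrite ler_norml lerNl opprB H// andbT distrC H.
move=> u1 v1; have u0 : 0 < u by exact: lt_le_trans u1.
have /le_trans -> // := lnB_le u0 (lt_le_trans ltr01 v1).
by rewrite ler_pdivrMr// (le_trans (ler_norm _))// ler_peMr.
Qed.

Lemma ln_succB_le (R : realType) (k : nat) : (0 < k)%N ->
  ln k.+1%:R - ln k%:R <= k%:R^-1 :> R.
Proof.
move=> k0; have := @lnB_le R k%:R k.+1%:R.
by rewrite !ltr0n => /(_ k0 isT); rewrite -natr1 addrAC subrr add0r mul1r.
Qed.

Lemma ln_le_sum_inv (R : realType) (m n : nat) : (0 < m <= n)%N ->
  ln n%:R - ln m%:R <= \sum_(m <= k < n) k%:R^-1 :> R.
Proof.
move=> /andP[m0 mn]; rewrite -(@telescope_sumr _ m n (fun k => ln k%:R))//.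
rewrite big_nat [leRHS]big_nat; apply: ler_sum => k /andP[mk _].
have k0 : (0 < k)%N := leq_trans m0 mk.
exact: ln_succB_le.
Qed.

Lemma sum_invS_le_ln (R : realType) (m n : nat) : (0 < m <= n)%N ->
  \sum_(m <= k < n) k.+1%:R^-1 <= ln n%:R - ln m%:R :> R.
Proof.
move=> /andP[m0 mn]; rewrite -(@telescope_sumr _ m n (fun k => ln k%:R))//.
rewrite big_nat [leRHS]big_nat; apply: ler_sum => k /andP[mk _].
have k0 : (0 < k)%N := leq_trans m0 mk.
have := @lnB_le R k.+1%:R k%:R; rewrite !ltr0n => /(_ isT k0).
by rewrite -natr1 opprD addrA subrr add0r mulN1r lerNr opprB.
Qed.

(** Telescoping places the sum between ln q - ln (p + 1) and ln (q - 1) - ln p;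
    moving the end points p + 1 and q - 1 to p and q costs at most 1/p below
    and nothing above. *)
Lemma sum_inv_between (R : realType) (p q : nat) : (0 < p < q)%N ->
  `|\sum_(p.+1 <= k < q) k%:R^-1 - (ln q%:R - ln p%:R)| <= p%:R^-1 :> R.
Proof.
case: q => [|q] /andP[p0 pq] //; rewrite ltnS in pq.
have p0R : 0 < p%:R :> R by rewrite ltr0n.
have lo : ln q.+1%:R - ln p.+1%:R <= \sum_(p.+1 <= k < q.+1) k%:R^-1 :> R.
  by rewrite ln_le_sum_inv.
have hi : \sum_(p.+1 <= k < q.+1) k%:R^-1 <= ln q%:R - ln p%:R :> R.
  by rewrite big_add1 sum_invS_le_ln// p0.
have lnpS : ln p.+1%:R - ln p%:R <= p%:R^-1 :> R.
  exact: ln_succB_le.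
have lnqS : ln q%:R <= ln q.+1%:R :> R.
  by rewrite ler_ln ?posrE ?ltr0n// ?ler_nat// (leq_trans p0).
have ip : 0 <= p%:R^-1 :> R by rewrite invr_ge0 ltW.
rewrite ler_norml; apply/andP; split; lra.
Qed.

(** * Fibonacci numbers and the golden ratio *)

(** The bounds are the quotients 377/233 = F_14/F_13 and 233/144 = F_13/F_12:
    consecutive quotients lie on opposite sides of the golden ratio, and these
    are close enough to decide its logarithm to four decimals. *)
Lemma golden_ratio_bounds (R : realType) :
  377 / 233 < golden_ratio R < 233 / 144.
Proof.
have s0 : 0 <= Num.sqrt 5 :> R by rewrite sqrtr_ge0.
have s2 : Num.sqrt 5 ^+ 2 = 5 :> R by rewrite sqr_sqrtr.
by rewrite /golden_ratio; apply/andP; split; nra.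
Qed.

Lemma golden_ratio_sqr (R : realType) :
  golden_ratio R ^+ 2 = golden_ratio R + 1.
Proof.
have s2 : Num.sqrt 5 ^+ 2 = 5 :> R by rewrite sqr_sqrtr.
by rewrite /golden_ratio; nra.
Qed.

Lemma fibSS n : fib n.+2 = (fib n.+1 + fib n)%N.
Proof. by []. Qed.

Lemma fib_gt0 n : (0 < n)%N -> (0 < fib n)%N.
Proof.
case: n => // n _; elim: n => // n IH.
by rewrite fibSS addn_gt0 IH.
Qed.

Lemma fib_ltS n : (1 < n)%N -> (fib n < fib n.+1)%N.
Proof.
by case: n => [|[|n]]// _; rewrite [fib n.+3]fibSS -ltn_subLR// subnn fib_gt0.
Qed.

(** The combination F_(n+1) - a F_n cancels the dominant term of Binet's
    formula: by a^2 = a + 1 it is multiplied by 1 - a when n increases. *)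
Lemma fib_golden_ratio (R : realType) n :
  (fib n.+1)%:R - golden_ratio R * (fib n)%:R = (1 - golden_ratio R) ^+ n.
Proof.
elim: n => [|n IH]; first by rewrite mulr0 subr0.
rewrite exprS -IH fibSS natrD; ring: (golden_ratio_sqr R).
Qed.

Lemma golden_ratio_conjX (R : realType) n :
  `|1 - golden_ratio R| ^+ n = golden_ratio R ^- n.
Proof.
have /andP[a1 _] := golden_ratio_bounds R.
rewrite -exprVn; congr (_ ^+ _); apply: (mulfI (x := golden_ratio R)); first by lra.
rewrite mulfV; last by lra.
rewrite ler0_norm; last by lra.
by have := golden_ratio_sqr R; lra.
Qed.

(** Both sides satisfy the Fibonacci recurrence, so the comparison reduces to
    n = 0 and n = 1. *)
Lemma golden_ratioX_le_fib (R : realType) n :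
  golden_ratio R ^+ n <= golden_ratio R * (fib n.+1)%:R.
Proof.
have /andP[a1 _] := golden_ratio_bounds R.
elim/ltn_ind: n => -[|[|n]] IH; rewrite ?mulr1 ?expr0 ?expr1//; first by lra.
rewrite -addn2 exprD golden_ratio_sqr addn2 fibSS natrD.
have := IH n (leqnSn _); have := IH n.+1 (leqnn _).
by rewrite exprS; lra.
Qed.

Lemma fib_inv_le (R : realType) n : (0 < n)%N ->
  (fib n)%:R^-1 <= golden_ratio R ^+ 2 * golden_ratio R ^- n.
Proof.
case: n => // n _; have /andP[a1 _] := golden_ratio_bounds R.
have a0 : 0 < golden_ratio R by lra.
have f0 : 0 < (fib n.+1)%:R :> R by rewrite ltr0n fib_gt0.
rewrite ler_pdivlMr ?exprn_gt0// ler_pdivrMl//.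
rewrite exprS expr2 mulrCA ler_pM2l// mulrC.
exact: golden_ratioX_le_fib.
Qed.

(** For n = 1 the gap is F_1 = F_2, which is outside the scope of
    [sum_inv_between]; the gaps between distinct numbers start at n = 2. *)
Lemma harmonic_gap_sum_ln (R : realType) n : (1 < n)%N ->
  `|harmonic_gap_sum R n - ln (golden_ratio R)| <=
  (golden_ratio R ^+ 2 + 1) * golden_ratio R ^- n.
Proof.
move=> n1; have n0 := ltnW n1; have /andP[a1 _] := golden_ratio_bounds R.
have p1 : 1 <= (fib n)%:R :> R by rewrite ler1n fib_gt0.
have q1 : 1 <= (fib n.+1)%:R :> R by rewrite ler1n fib_gt0.
have ap1 : 1 <= golden_ratio R * (fib n)%:R by nra.
have := ln_lipschitz ap1 q1.
rewrite fib_golden_ratio normrX golden_ratio_conjX lnM ?posrE; try lra.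
have := @sum_inv_between R (fib n) (fib n.+1).
rewrite fib_gt0// fib_ltS// => /(_ isT); rewrite -/(harmonic_gap_sum R n).
have := fib_inv_le R n0.
rewrite !ler_norml mulrDl mul1r => ? /andP[? ?] /andP[? ?].
apply/andP; split; lra.
Qed.

(** * Numerical value of the logarithm of the golden ratio *)

(** Once 2 x <= n + 1, each term of the exponential series from index n on is
    at most half of the preceding one, so the tail is dominated by the
    geometric series of ratio 1/2 that starts with the term of index n. *)
Lemma expR_taylor_bounds (R : realType) (x : R) (n : nat) :
  0 <= x -> 2 * x <= n.+1%:R ->
  series (exp_coeff x) n <= expR x <=
    series (exp_coeff x) n + 2 * exp_coeff x n.
Proof.
move=> x0 xn; have c0 k : 0 <= exp_coeff x k by exact: exp_coeff_ge0.
have cvg := is_cvg_series_exp_coeff x.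
apply/andP; split.
  apply: nondecreasing_cvgn_le => //.
  by apply: nondecreasing_series => k _ _.
have dec k : (n <= k)%N -> 2 * exp_coeff x k.+1 <= exp_coeff x k.
  move=> nk; have -> : exp_coeff x k.+1 = exp_coeff x k * (x / k.+1%:R).
    rewrite /exp_coeff/= exprSr factS natrM; field.
    by rewrite nat1r !pnatr_eq0 -!lt0n fact_gt0.
  rewrite mulrCA ler_piMr// mulrA ler_pdivrMr ?ltr0n// mul1r.
  by rewrite (le_trans xn)// ler_nat.
(* The upper bounds obtained from larger and larger n are nonincreasing. *)
have tail d : series (exp_coeff x) (n + d)%N + 2 * exp_coeff x (n + d)%N <=
    series (exp_coeff x) n + 2 * exp_coeff x n.
  elim: d => [|d IH]; first by rewrite !addn0.
  apply: le_trans IH; rewrite addnS /series/= big_nat_recr//= -addrA lerD2l.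
  by have := dec _ (leq_addr d n); lra.
apply: limr_le => //; exists n => // k /= nk.
have := tail (k - n)%N; rewrite subnKC//; have := c0 k; lra.
Qed.

(** Fractions with small denominators such that 115/239 > 0.48115 and
    77/160 = 0.48125: the interval lies within 0.00005 of 0.4812. *)
Lemma ln_golden_ratio_bounds (R : realType) :
  115 / 239 < ln (golden_ratio R) < 77 / 160.
Proof.
have /andP[a1 a2] := golden_ratio_bounds R.
have a0 : golden_ratio R \is Num.pos by rewrite posrE; lra.
have taylor (x : R) : 0 <= x <= 1 ->
    let s := 1 + x + x ^+ 2 / 2 + x ^+ 3 / 6 + x ^+ 4 / 24 + x ^+ 5 / 120 in
    s <= expR x <= s + x ^+ 6 / 360.
  move=> /andP[x0 x1]; set s := (X in let _ := X in _); rewrite /=.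
  have := @expR_taylor_bounds R x 6 x0.
  have -> : series (exp_coeff x) 6 = s.
    rewrite /series/= !big_nat_recr//= big_geq// /exp_coeff/= /s.
    by rewrite !factS fact0; field.
  have -> : 2 * exp_coeff x 6 = x ^+ 6 / 360.
    by rewrite /exp_coeff/= !factS fact0; field.
  by apply; lra.
rewrite -![_ < ln _]ltr_expR -![ln _ < _]ltr_expR lnK//.
apply/andP; split.
  have /andP[_ H] := taylor (115 / 239) ltac:(lra).
  by apply: (le_lt_trans H); lra.
have /andP[H _] := taylor (77 / 160) ltac:(lra).
by apply: lt_le_trans H; lra.
Qed.

Theorem lemma4p2 (R : realType) :
  [/\ harmonic_gap_sum R = (fun _ : nat => ln (golden_ratio R))
        +O_ \oo (fun n : nat => golden_ratio R ^- n),
      harmonic_gap_sum R n @[n --> \oo] --> ln (golden_ratio R) &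
      `|ln (golden_ratio R) - 4812 / 10 ^+ 4| < 10 ^- 4 / 2].
Proof.
have /andP[a1 _] := golden_ratio_bounds R.
have a0 : 0 < golden_ratio R by lra.
have bound := @harmonic_gap_sum_ln R.
split.
- apply/eqaddOP; near=> k; exists 2%N => // n /= n2.
  rewrite (@ger0_norm _ (_ ^- n)) ?invr_ge0 ?exprn_ge0 ?ltW//.
  apply: (le_lt_trans (bound n n2)); rewrite ltr_pM2r ?invr_gt0 ?exprn_gt0//.
  by near: k; apply: nbhs_pinfty_gt; rewrite num_real.
- apply/subr_cvg0; apply: norm_cvg0.
  apply: (@squeeze_cvgr _ _ _ _ (fun=> 0)
    (geometric (golden_ratio R ^+ 2 + 1) (golden_ratio R)^-1)).
  + exists 2%N => // n /= n2.
    by rewrite normr_ge0/= exprVn bound.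
  + exact: cvg_cst.
  + apply: cvg_geometric; rewrite ger0_norm ?invr_ge0 ?ltW//.
    by rewrite invf_cp1//; lra.
- have := ln_golden_ratio_bounds R.
  by move=> /andP[? ?]; rewrite ltr_norml; apply/andP; split; lra.
Unshelve. all: by end_near.
Qed.
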